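(* Let $\phi: M_3 \to M_3$ be a linear preserver of the Lorentz spectrum. Then there exists an orthogonal matrix $Q \in M_2$ such that $$\phi(A) = \begin{bmatrix} Q & 0 \\ 0 & 1\end{bmatrix} A \begin{bmatrix} Q^T & 0 \\ 0 & 1\end{bmatrix} \quad \text{for all } A \in M_3.$$
   Context: $M_n$ denotes the vector space of $n\times n$ real matrices. The Lorentz cone in $\mathbb{R}^3$ is $\mathcal{K}_3=\{[\xi^T,\eta]^T : \xi\in\mathbb{R}^2,\ \eta\in\mathbb{R},\ \|\xi\|_2\le \eta\}$. For $A\in M_3$, a real number $\lambda$ is a Lorentz eigenvalue of $A$ if there is a nonzero $x\in\mathbb{R}^3$ with $x\in\mathcal{K}_3$, $(A-\lambda I)x\in\mathcal{K}_3$ and $x^T(A-\lambda I)x=0$. The Lorentz spectrum $\sigma_L(A)$ is the set of all Lorentz eigenvalues of $A$. A linear preserver of the Lorentz spectrum on $M_3$ is a linear map $\phi:M_3\to M_3$ such that $\sigma_L(\phi(A))=\sigma_L(A)$ for all $A\in M_3$. *)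

(* Defs.v *)
From mathcomp Require Import all_boot all_order all_algebra.
From mathcomp Require Import classical_sets reals.

Set Implicit Arguments.
Unset Strict Implicit.
Unset Printing Implicit Defensive.

Import Order.TTheory GRing.Theory Num.Theory.

Local Open Scope classical_set_scope.
Local Open Scope ring_scope.

Definition norm2 (R : realType) (n : nat) (x : 'cV[R]_n) : R :=
  Num.sqrt (\sum_(i < n) x i 0 ^+ 2).

(* A vector [xi^T, eta]^T is indexed by 'I_(n + 1), so that its blocks xi and
   eta are usubmx and dsubmx; R^3 is the case n = 2, where 'M_(2 + 1) is
   convertible to 'M_3. *)
Definition lorentz_cone (R : realType) (n : nat) : set 'cV[R]_(n + 1) :=
  [set x | norm2 (usubmx x) <= dsubmx x 0 0].

Definition lorentz_eigenvalue (R : realType) (n : nat)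
    (A : 'M[R]_(n + 1)) (lambda : R) : Prop :=
  exists x : 'cV[R]_(n + 1),
    [/\ x != 0, lorentz_cone x, lorentz_cone ((A - lambda%:M) *m x)
      & x^T *m ((A - lambda%:M) *m x) = 0].

Definition lorentz_spectrum (R : realType) (n : nat) (A : 'M[R]_(n + 1)) :
    set R :=
  [set lambda | lorentz_eigenvalue A lambda].

Definition lorentz_spectrum_preserver (R : realType) (n : nat)
    (phi : 'M[R]_(n + 1) -> 'M[R]_(n + 1)) : Prop :=
  forall A, lorentz_spectrum (phi A) = lorentz_spectrum A.

Definition orthogonal_mx (R : realType) (n : nat) (Q : 'M[R]_n) : Prop :=
  Q *m Q^T = 1%:M /\ Q^T *m Q = 1%:M.

(* Main.v *)
(* Write A = [B b; c^T d].  The Lorentz eigenvalues of A with an eigenvector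
   (xi, 1) on the boundary of the cone are read off the zeros on the unit circle
   of f(xi) = xi x (B xi + b), a trigonometric polynomial of degree 2: they equal
   g(xi) / 2 with g(xi) = xi.(B xi + b) + c.xi + d, provided that
   xi.(B xi + b) <= c.xi + d.
   Hence an infinite spectrum forces f = 0, i.e. B = a I and b = 0, so phi
   preserves the space of these matrices; comparing the extremities of the
   spectra there gives phi(a I, 0, c, d) = (a I, 0, Q c, d) with Q orthogonal,
   and conjugating by Q reduces to Q = 1.
   Adding (0, 0, t xi0, D) with D >> t >> 0 isolates the eigenvalue carried by
   xi0 and shows that f_A(xi0) = 0 implies f_(phi A)(xi0) = 0 and
   g_(phi A)(xi0) = g_A(xi0).  So the f and g of phi A - A are multiples of f_A
   by factors independent of A; degree considerations force both to vanish,
   that is phi A = A + k (I, 0, 0, -1).  Matrices without boundary eigenvectors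
   but with an interior one show that k = 0. *)

Require Import Defs.
From mathcomp Require Import all_boot all_order all_algebra.
From mathcomp Require Import classical_sets reals.
From mathcomp Require Import boolp ring lra.

Set Implicit Arguments.
Unset Strict Implicit.
Unset Printing Implicit Defensive.

Import Order.TTheory GRing.Theory Num.Theory.

Local Open Scope ring_scope.

(** Literal indices, so that simplification decides comparisons between them and evaluates entries
    of [delta_mx] and [vec3]. *)
Definition o0 : 'I_(2 + 1) := @Ordinal (2 + 1) 0 isT.
Definition o1 : 'I_(2 + 1) := @Ordinal (2 + 1) 1 isT.
Definition o2 : 'I_(2 + 1) := @Ordinal (2 + 1) 2 isT.

Lemma ord3P (P : 'I_(2 + 1) -> Prop) : P o0 -> P o1 -> P o2 -> forall i, P i.
Proof.
move=> P0 P1 P2 [[|[|[|//]]] hi].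
- by rewrite (_ : Ordinal hi = o0) //; apply/val_inj.
- by rewrite (_ : Ordinal hi = o1) //; apply/val_inj.
- by rewrite (_ : Ordinal hi = o2) //; apply/val_inj.
Qed.

Lemma sum3 (V : nmodType) (F : 'I_(2 + 1) -> V) :
  \sum_i F i = F o0 + F o1 + F o2.
Proof.
rewrite !big_ord_recl big_ord0 addr0 addrA.
by congr (F _ + F _ + F _); apply/val_inj.
Qed.

(** * Spectrum in coordinates *)

Section Coordinates.
Variable R : realType.
Implicit Types (A : 'M[R]_(2 + 1)) (x y lam : R).

Lemma sumsqr_le0 (a b : R) : a ^+ 2 + b ^+ 2 <= 0 -> a = 0 /\ b = 0.
Proof.
move=> h; have /eqP : a ^+ 2 + b ^+ 2 = 0.
  by apply/eqP; rewrite eq_le h addr_ge0 ?sqr_ge0.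
by rewrite paddr_eq0 ?sqr_ge0 // !sqrf_eq0 => /andP[/eqP -> /eqP ->].
Qed.

Definition vec3 (x y z : R) : 'cV[R]_(2 + 1) := \col_i [:: x; y; z]`_i.

Lemma vec3_eta (v : 'cV[R]_(2 + 1)) : v = vec3 (v o0 0) (v o1 0) (v o2 0).
Proof. by apply/colP; apply: ord3P; rewrite mxE. Qed.

Lemma lorentz_cone_vec3 (x y z : R) :
  lorentz_cone (vec3 x y z) <-> 0 <= z /\ x ^+ 2 + y ^+ 2 <= z ^+ 2.
Proof.
rewrite /lorentz_cone /norm2 /= big_ord_recl big_ord1 !mxE /=.
split=> [h|[z0 h]]; last by rewrite -(ger0_norm z0) -sqrtr_sqr ler_wsqrtr.
have z0 : 0 <= z by apply: le_trans h; rewrite sqrtr_ge0.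
split=> //; rewrite -(@sqr_sqrtr _ (x ^+ 2 + y ^+ 2)) ?addr_ge0 ?sqr_ge0 //.
by rewrite ler_sqr // nnegrE ?sqrtr_ge0.
Qed.

(** At the vector (x, y, 1), [radial] and [angular] are the dot and cross products of (x, y) with
    the planar part of the image under [A], and [height] is the last coordinate of that image. *)
Definition arow A (i : 'I_(2 + 1)) x y : R := A i o0 * x + A i o1 * y + A i o2.
Definition radial A x y : R := x * arow A o0 x y + y * arow A o1 x y.
Definition angular A x y : R := x * arow A o1 x y - y * arow A o0 x y.
Definition height A x y : R := arow A o2 x y.

(** A cone vector with last coordinate 0 is zero, so eigenvectors scale to (p, q, 1). If (u, w, n)
    is the image under A - lam, orthogonality gives n = -(p u + q w), and Cauchy-Schwarz with the
    two cone conditions leaves two cases: (u, w) = -n (p, q) on the circle, or (u, w, n) = 0 inside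
    it. *)
Lemma lorentz_spectrum3P A lam :
  lorentz_spectrum A lam <->
  (exists x y, [/\ x ^+ 2 + y ^+ 2 = 1, angular A x y = 0,
     2 * lam = radial A x y + height A x y & radial A x y <= height A x y]) \/
  (exists x y, [/\ x ^+ 2 + y ^+ 2 < 1, arow A o0 x y = lam * x,
     arow A o1 x y = lam * y & height A x y = lam]).
Proof.
have mulE x y z : (A - lam%:M) *m vec3 x y z =
    vec3 (A o0 o0 * x + A o0 o1 * y + A o0 o2 * z - lam * x)
         (A o1 o0 * x + A o1 o1 * y + A o1 o2 * z - lam * y)
         (A o2 o0 * x + A o2 o1 * y + A o2 o2 * z - lam * z).
  by apply/colP; apply: ord3P; rewrite !mxE sum3 !mxE /= ?mulr1n ?mulr0n; ring.
have dotE x y z x' y' z' : ((vec3 x y z)^T *m vec3 x' y' z' == 0) =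
    (x * x' + y * y' + z * z' == 0).
  apply/eqP/eqP => [/matrixP/(_ 0 0)|h]; first by rewrite !mxE sum3 !mxE.
  by apply/matrixP => i j; rewrite !ord1 !mxE sum3 !mxE /=.
have vec30 : vec3 0 0 0 = 0 by apply/colP; apply: ord3P; rewrite !mxE.
split.
- case=> v []; rewrite (vec3_eta v); move: (v o0 0) (v o1 0) (v o2 0) => x y z.
  rewrite mulE => v0 /lorentz_cone_vec3[z0 xyz] /lorentz_cone_vec3[w0 uvw].
  move/eqP; rewrite dotE => /eqP dot.
  have zP : 0 < z.
    rewrite lt0r z0 andbT; apply: contraNneq v0 => zE; move: xyz.
    by rewrite zE expr0n /= => /sumsqr_le0[-> ->]; rewrite vec30.
  have zN : z != 0 by rewrite gt_eqF.
  have eqx : x = z * (x / z) by field.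
  have eqy : y = z * (y / z) by field.
  move: (x / z) (y / z) eqx eqy => p q eqx eqy; subst x y.
  set u := arow A o0 p q - lam * p; set w := arow A o1 p q - lam * q.
  set n := height A p q - lam.
  have n0 : 0 <= n.
    rewrite -(pmulr_rge0 _ zP) (le_trans w0) // le_eqVlt; apply/orP; left.
    by apply/eqP; rewrite /n /height /arow; ring.
  have pq : p ^+ 2 + q ^+ 2 <= 1.
    have : z ^+ 2 * (p ^+ 2 + q ^+ 2 - 1) <= 0.
      by move: xyz; rewrite -subr_le0; congr (_ <= 0); ring.
    by rewrite pmulr_rle0 ?exprn_gt0 // subr_le0.
  have uw : u ^+ 2 + w ^+ 2 <= n ^+ 2.
    have : z ^+ 2 * (u ^+ 2 + w ^+ 2 - n ^+ 2) <= 0.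
      move: uvw; rewrite -subr_le0; congr (_ <= 0).
      by rewrite /u /w /n /height /arow; ring.
    by rewrite pmulr_rle0 ?exprn_gt0 // subr_le0.
  have d0 : p * u + q * w + n = 0.
    have /eqP : z ^+ 2 * (p * u + q * w + n) = 0.
      by rewrite /u /w /n /height /arow -dot; ring.
    by rewrite mulf_eq0 sqrf_eq0 (negbTE zN) /= => /eqP.
  have [pq1|pq1] := eqVneq (p ^+ 2 + q ^+ 2) 1.
    left; exists p, q.
    (* Equality case of Cauchy-Schwarz: under [d0] and [pq1] the sum of the two squares is u^2 + w^2
       - n^2, which is at most 0. *)
    have [hu hw] : u + n * p = 0 /\ w + n * q = 0.
      apply: sumsqr_le0.
      have -> : (u + n * p) ^+ 2 + (w + n * q) ^+ 2 =
        u ^+ 2 + w ^+ 2 + 2 * n * (p * u + q * w + n) - n ^+ 2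
          + n ^+ 2 * (p ^+ 2 + q ^+ 2 - 1) by ring.
      by rewrite d0 pq1 subrr !mulr0 !addr0 subr_le0.
    have e0 : arow A o0 p q = (lam - n) * p by move: hu; rewrite /u; lra.
    have e1 : arow A o1 p q = (lam - n) * q by move: hw; rewrite /w; lra.
    have er : radial A p q = lam - n.
      by rewrite /radial e0 e1 -[RHS]mulr1 -pq1; ring.
    split => //.
    + by rewrite /angular e0 e1; ring.
    + by rewrite er /n; ring.
    + by rewrite er; move: n0; rewrite /n; lra.
  right; exists p, q.
  have lt1 : p ^+ 2 + q ^+ 2 < 1 by rewrite lt_neqAle pq1.
  have nE : n = 0.
    (* Cauchy-Schwarz and [uw] give n^2 <= n^2 (p^2 + q^2), where the last factor is less than 1. *)
    have cs : n ^+ 2 <= (u ^+ 2 + w ^+ 2) * (p ^+ 2 + q ^+ 2).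
      have -> : n = - (p * u + q * w) by move: d0; clear; lra.
      rewrite -subr_ge0; have -> : (u ^+ 2 + w ^+ 2) * (p ^+ 2 + q ^+ 2)
        - (- (p * u + q * w)) ^+ 2 = (p * w - q * u) ^+ 2 by ring.
      exact: sqr_ge0.
    have pq0 : 0 <= p ^+ 2 + q ^+ 2 by rewrite addr_ge0 ?sqr_ge0.
    apply/eqP; rewrite -sqrf_eq0 eq_le sqr_ge0 andbT.
    rewrite -(@pmulr_lle0 _ (1 - (p ^+ 2 + q ^+ 2))) ?subr_gt0 //.
    by rewrite mulrBr mulr1 subr_le0 (le_trans cs) // ler_wpM2r.
  have [hu hw] : u = 0 /\ w = 0.
    by apply: sumsqr_le0; rewrite (le_trans uw) // nE expr0n.
  by split => //; move: hu hw nE; rewrite /u /w /n; lra.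
- have nz x y : vec3 x y 1 != 0.
    apply/eqP => /colP/(_ o2); rewrite !mxE /= => /eqP.
    by rewrite oner_eq0.
  case=> [[x [y [xy a0 lamE rh]]]|[x [y [xy e0 e1 e2]]]]; exists (vec3 x y 1).
  (* On the circle the planar part of the image is [radial] times (x, y) plus [angular] times (-y,
     x). *)
  + have e0 : arow A o0 x y = radial A x y * x.
      rewrite /radial -[LHS]mul1r -xy.
      by transitivity (x * (x * arow A o0 x y + y * arow A o1 x y)
        - y * angular A x y); [rewrite /angular; ring | rewrite a0; ring].
    have e1 : arow A o1 x y = radial A x y * y.
      rewrite /radial -[LHS]mul1r -xy.
      by transitivity (y * (x * arow A o0 x y + y * arow A o1 x y)
        + x * angular A x y); [rewrite /angular; ring | rewrite a0; ring].
    rewrite mulE !mulr1 -!/(arow _ _ _ _) -/(height A x y) e0 e1.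
    split=> //.
    * by apply/lorentz_cone_vec3; rewrite xy expr1n.
    * apply/lorentz_cone_vec3; split; first by lra.
      have -> : height A x y = 2 * lam - radial A x y by lra.
      rewrite -!mulrBl !exprMn -mulrDr xy; lra.
    * apply/eqP; rewrite dotE; apply/eqP.
      have -> : height A x y = 2 * lam - radial A x y by lra.
      by transitivity ((radial A x y - lam) * (x ^+ 2 + y ^+ 2 - 1)); [ring|rewrite xy; ring].
  + rewrite mulE !mulr1 -!/(arow _ _ _ _) -/(height A x y) e0 e1 e2 !subrr vec30.
    split=> //.
    * by apply/lorentz_cone_vec3; rewrite expr1n; split => //; exact: ltW.
    * by rewrite -vec30; apply/lorentz_cone_vec3; rewrite expr0n addr0.
    * by rewrite mulmx0.
Qed.
End Coordinates.

(** * Infinite spectra *)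

Lemma poly_roots_seq (K : fieldType) (p : {poly K}) :
  p != 0 -> exists s : seq K, forall x, root p x -> x \in s.
Proof.
have [n] := ubnP (size p); elim: n p => // n IHn p sp p0.
have [[a pa]|nroot] := pselect (exists a, root p a); last first.
  by exists [::] => x px; case: nroot; exists x.
have [q pE] := factor_theorem _ _ pa; move: p0 sp; rewrite pE => qX0.
have q0 : q != 0 by apply: contraNneq qX0 => ->; rewrite mul0r.
rewrite size_Mmonic ?monicXsubC // size_XsubC addn2 /= => sq.
have [s hs] := IHn _ sq q0.
exists (a :: s) => x; rewrite rootM root_XsubC inE.
by case/orP => [/hs ->|->]; rewrite ?orbT.
Qed.

Section Finite.
Variable R : realType.
Implicit Types (A : 'M[R]_(2 + 1)) (x y lam : R).

(** These are exactly the matrices whose [angular] vanishes on the whole unit circle. *)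
Definition flat_mx A : Prop :=
  [/\ A o0 o1 = 0, A o1 o0 = 0, A o0 o2 = 0, A o1 o2 = 0 & A o0 o0 = A o1 o1].

(* Eliminating [y] between [angular A x y = 0] and [x ^+ 2 + y ^+ 2 = 1]. *)
Definition quartic A : {poly R} :=
  let k := A o1 o0 + A o0 o1 in let m := A o1 o1 - A o0 o0 in
  Poly [:: A o0 o2 ^+ 2 - A o0 o1 ^+ 2;
    2 * (A o1 o2 * A o0 o1 - m * A o0 o2);
    m ^+ 2 - A o0 o2 ^+ 2 - A o1 o2 ^+ 2 + 2 * k * A o0 o1;
    2 * (m * A o0 o2 - k * A o1 o2);
    - (m ^+ 2 + k ^+ 2)].

(** The coefficients of degrees 4, 2 and 0 become, in turn, minus a sum of squares once the
    preceding ones vanish. *)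
Lemma quartic_neq0 A : ~ flat_mx A -> quartic A != 0.
Proof.
move=> nA; apply/eqP => A0; apply: nA.
have coef i : (quartic A)`_i = 0 by rewrite A0 coef0.
move: (coef 0) (coef 2) (coef 4); rewrite !coef_Poly /= => c0 c2 c4.
have [m0 k0] : A o1 o1 - A o0 o0 = 0 /\ A o1 o0 + A o0 o1 = 0.
  by apply: sumsqr_le0; rewrite -oppr_ge0 c4.
have [b0 b1] : A o0 o2 = 0 /\ A o1 o2 = 0.
  apply: sumsqr_le0; move: c2; rewrite m0 k0 expr0n /= mulr0 mul0r addr0 sub0r => c2.
  by rewrite -oppr_ge0 opprD c2.
move: c0; rewrite b0 expr0n /= sub0r => /eqP.
rewrite oppr_eq0 sqrf_eq0 => /eqP q0.
move: k0; rewrite q0 addr0 => r0; split => //.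
by apply/esym/eqP; rewrite -subr_eq0 m0.
Qed.

Lemma root_quartic A x y :
  x ^+ 2 + y ^+ 2 = 1 -> angular A x y = 0 -> root (quartic A) x.
Proof.
move=> xy; rewrite /angular /arow /root horner_Poly /= => ang; apply/eqP.
have y2 : y ^+ 2 = 1 - x ^+ 2 by rewrite -xy; ring.
set m := A o1 o1 - A o0 o0.
(* With y^2 replaced by 1 - x^2, [angular A x y] is S + y (m x - A o0 o2); isolating y and squaring
   gives the quartic. *)
set S := (A o1 o0 + A o0 o1) * x ^+ 2 + A o1 o2 * x - A o0 o1.
transitivity ((1 - x ^+ 2) * (m * x - A o0 o2) ^+ 2 - S ^+ 2).
  by rewrite /S /m; ring.
have -> : S = - (y * (m * x - A o0 o2)).
  apply/eqP; rewrite -addr_eq0; apply/eqP.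
  have -> : S = A o1 o0 * x ^+ 2 - A o0 o1 * (1 - x ^+ 2) + A o1 o2 * x.
    by rewrite /S; ring.
  by rewrite -y2 -ang /m; ring.
by rewrite -y2; ring.
Qed.

(** Here (x, y, 1) is an ordinary eigenvector; the transpose appears because [eigenvalue] refers to
    row vectors. *)
Lemma interior_eigenvalue A x y lam :
  arow A o0 x y = lam * x -> arow A o1 x y = lam * y -> height A x y = lam ->
  root (char_poly A^T) lam.
Proof.
move=> e0 e1 e2; rewrite -eigenvalue_root_char; apply/eigenvalueP.
exists (vec3 x y 1)^T.
  apply/rowP; apply: ord3P; rewrite !mxE ?sum3 ?mxE /= ?mulr1.
  - by rewrite -e0 /arow; ring.
  - by rewrite -e1 /arow; ring.
  - by rewrite -[RHS]e2 /height /arow; ring.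
by apply/eqP => /rowP/(_ o2); rewrite !mxE /= => /eqP; rewrite oner_eq0.
Qed.

Lemma lorentz_spectrum_seq A : ~ flat_mx A ->
  exists s : seq R, forall lam, lorentz_spectrum A lam -> lam \in s.
Proof.
move=> /quartic_neq0/poly_roots_seq[s hs].
have [t ht] := poly_roots_seq (monic_neq0 (char_poly_monic A^T)).
pose g x y := (radial A x y + height A x y) / 2.
(* Interior eigenvalues lie in [t]. A boundary one is determined by x, a root of the quartic, and
   the sign of y. *)
exists (t ++ [seq g x (e * Num.sqrt (1 - x ^+ 2)) | x <- s, e <- [:: 1; -1]]).
move=> lam; rewrite lorentz_spectrum3P mem_cat.
case=> [[x [y [xy ang lamE _]]]|[x [y [_ e0 e1 e2]]]]; apply/orP; last first.
  by left; apply: ht; apply: interior_eigenvalue e0 e1 e2.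
right; have y2 : 1 - x ^+ 2 = y ^+ 2 by rewrite -xy; ring.
have lamg : lam = g x y by rewrite /g -lamE; field.
have xs := hs _ (root_quartic xy ang).
apply/allpairsP; have : y ^+ 2 == Num.sqrt (1 - x ^+ 2) ^+ 2.
  by rewrite y2 sqr_sqrtr ?sqr_ge0.
rewrite eqf_sqr => /orP[|] /eqP yE.
  by exists (x, 1); rewrite /= mul1r -yE xs inE eqxx.
by exists (x, -1); rewrite /= mulN1r -yE xs !inE eqxx orbT.
Qed.

Lemma seq_misses_interval (a b : R) (s : seq R) : a < b ->
  exists t, [/\ a < t, t <= b & t \notin s].
Proof.
move=> ab; apply: contrapT => h.
(* Pigeonhole: these points of (a, b] are pairwise distinct, so [size s] + 1 of them cannot all lie
   in [s]. *)
pose f (n : nat) := a + (b - a) / n.+1%:R.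
have finj : injective f.
  move=> m n /addrI /mulfI; rewrite subr_eq0 gt_eqF // => /(_ isT)/invr_inj/eqP.
  by rewrite eqr_nat eqSS => /eqP.
suff fs : {subset [seq f i | i <- iota 0 (size s).+1] <= s}.
  have := uniq_leq_size _ fs; rewrite map_inj_uniq // iota_uniq => /(_ isT).
  by rewrite size_map size_iota ltnn.
move=> _ /mapP[n _ ->]; apply: contrapT => /negP fn; case: h; exists (f n).
split=> //; first by rewrite ltrDl divr_gt0 ?subr_gt0.
rewrite -lerBrDl ler_pdivrMr // ler_peMr ?subr_ge0 ?(ltW ab) //.
by rewrite ler1n.
Qed.
End Finite.

(** * Spectra of flat matrices *)

Section Flat.
Variable R : realType.
Implicit Types (A : 'M[R]_(2 + 1)) (x y lam : R).

Definition hypot (a b : R) : R := Num.sqrt (a ^+ 2 + b ^+ 2).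

Lemma hypot_ge0 a b : 0 <= hypot a b.
Proof. exact: sqrtr_ge0. Qed.

Lemma hypot_sqr a b : hypot a b ^+ 2 = a ^+ 2 + b ^+ 2.
Proof. by rewrite sqr_sqrtr // addr_ge0 ?sqr_ge0. Qed.

Lemma hypotN a b : hypot (- a) (- b) = hypot a b.
Proof. by rewrite /hypot !sqrrN. Qed.

Lemma norm_le_hypot t a b : (`|t| <= hypot a b) = (t ^+ 2 <= a ^+ 2 + b ^+ 2).
Proof. by rewrite -hypot_sqr -(real_normK (num_real t)) ler_sqr ?nnegrE ?hypot_ge0. Qed.

Lemma norm_lt_hypot t a b : (`|t| < hypot a b) = (t ^+ 2 < a ^+ 2 + b ^+ 2).
Proof. by rewrite -hypot_sqr -(real_normK (num_real t)) ltr_sqr ?nnegrE ?hypot_ge0. Qed.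

Lemma dot_le_hypot a b x y : x ^+ 2 + y ^+ 2 <= 1 -> `|a * x + b * y| <= hypot a b.
Proof.
move=> xy; rewrite norm_le_hypot.
have h : 0 <= (a ^+ 2 + b ^+ 2) * (1 - (x ^+ 2 + y ^+ 2)).
  by rewrite mulr_ge0 ?subr_ge0 // addr_ge0 ?sqr_ge0.
rewrite -subr_ge0; have -> : a ^+ 2 + b ^+ 2 - (a * x + b * y) ^+ 2 =
  (a ^+ 2 + b ^+ 2) * (1 - (x ^+ 2 + y ^+ 2)) + (a * y - b * x) ^+ 2 by ring.
by rewrite addr_ge0 ?sqr_ge0.
Qed.

Lemma dot_unit_surj t a b : `|t| <= hypot a b ->
  exists x y, x ^+ 2 + y ^+ 2 = 1 /\ a * x + b * y = t.
Proof.
have [h0|h0] := eqVneq (hypot a b) 0.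
  rewrite h0 normr_le0 => /eqP ->.
  have [-> ->] : a = 0 /\ b = 0.
    by apply: sumsqr_le0; rewrite -hypot_sqr h0 expr0n.
  by exists 1, 0; split; ring.
rewrite norm_le_hypot -hypot_sqr => th; have h2 := hypot_sqr a b.
set h := hypot a b in h0 th h2 *.
have hP : 0 < h by rewrite lt0r h0 hypot_ge0.
(* The witness is (a, b) / h rotated by the angle with cosine u and sine v. *)
set u := t / h; set v := Num.sqrt (1 - u ^+ 2).
have v2 : v ^+ 2 = 1 - u ^+ 2.
  by rewrite sqr_sqrtr // subr_ge0 /u expr_div_n ler_pdivrMr ?exprn_gt0 // mul1r.
exists ((u * a - v * b) / h), ((u * b + v * a) / h); split.
- transitivity ((u ^+ 2 + v ^+ 2) * (a ^+ 2 + b ^+ 2) / h ^+ 2); first by field.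
  by rewrite v2 -h2; field.
- transitivity (u * (a ^+ 2 + b ^+ 2) / h); first by field.
  by rewrite -h2 /u; field.
Qed.

(** Every point of the circle has [angular] zero. At an interior eigenvector, (A o0 o0 - lam) kills
    x and y, so either lam = A o0 o0 or the eigenvector is the centre, with eigenvalue A o2 o2. *)
Lemma flat_lorentz_spectrum A lam : flat_mx A ->
  lorentz_spectrum A lam <->
  [\/ exists x y, [/\ x ^+ 2 + y ^+ 2 = 1, 2 * lam = A o0 o0 + height A x y
        & A o0 o0 <= height A x y],
    lam = A o2 o2 |
    lam = A o0 o0 /\ exists x y, x ^+ 2 + y ^+ 2 < 1 /\ height A x y = A o0 o0].
Proof.
case=> z01 z10 z02 z12 a11.
have r0 x y : arow A o0 x y = A o0 o0 * x by rewrite /arow z01 z02; ring.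
have r1 x y : arow A o1 x y = A o0 o0 * y by rewrite /arow z10 z12 -a11; ring.
have an x y : angular A x y = 0 by rewrite /angular r0 r1; ring.
have rad x y : x ^+ 2 + y ^+ 2 = 1 -> radial A x y = A o0 o0.
  by move=> xy; rewrite /radial r0 r1 -[RHS]mulr1 -xy; ring.
rewrite lorentz_spectrum3P; split.
  case=> [[x [y [xy _ lamE le]]]|[x [y [xy]]]].
    by apply: Or31; exists x, y; rewrite lamE -(rad _ _ xy).
  rewrite r0 r1 => e0 e1 e2.
  have [lE|lN] := eqVneq lam (A o0 o0).
    by apply: Or33; split=> //; exists x, y; rewrite -lE.
  apply: Or32; rewrite -e2 /height /arow.
  have nz z : A o0 o0 * z = lam * z -> z = 0.
    move/eqP; rewrite -subr_eq0 -mulrBl mulf_eq0 subr_eq0 eq_sym (negbTE lN).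
    by move/eqP.
  by rewrite (nz x) // (nz y) // !mulr0 !add0r.
case=> [[x [y [xy lamE le]]]|->|[-> [x [y [xy e]]]]].
- by left; exists x, y; rewrite an rad.
- right; exists 0, 0; rewrite r0 r1 /height /arow !mulr0 !add0r expr0n addr0.
  by split=> //; exact: ltr01.
- by right; exists x, y; rewrite r0 r1.
Qed.

(** On the circle [height] sweeps the interval of radius [hypot] around A o2 o2. By hypothesis this
    interval contains A o0 o0, and the boundary eigenvalues come from its part above A o0 o0. *)
Lemma flat_spectrum_interval A lam : flat_mx A ->
  (A o2 o2 - A o0 o0) ^+ 2 <= A o2 o0 ^+ 2 + A o2 o1 ^+ 2 ->
  lorentz_spectrum A lam <->
  lam = A o2 o2 \/
  A o0 o0 <= lam /\ 2 * lam <= A o0 o0 + A o2 o2 + hypot (A o2 o0) (A o2 o1).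
Proof.
move=> fA; rewrite -norm_le_hypot ler_norml => /andP[dl dr].
rewrite flat_lorentz_spectrum //; split.
  case=> [[x [y [xy lamE le]]]|->|[-> [x [y [xy e]]]]]; [right|by left|right].
    split; first by clear -lamE le; lra.
    have : `|A o2 o0 * x + A o2 o1 * y| <= hypot (A o2 o0) (A o2 o1).
      by apply: dot_le_hypot; rewrite xy.
    by rewrite lamE /height /arow ler_norml => /andP[_]; clear; lra.
  by split => //; clear -dl; lra.
case=> [->|[ge le]]; first exact: Or32.
apply: Or31.
have [|x [y [xy e]]] :=
    @dot_unit_surj (2 * lam - A o0 o0 - A o2 o2) (A o2 o0) (A o2 o1).
  by rewrite ler_norml; apply/andP; split; clear -ge le dl dr; lra.
by exists x, y; rewrite /height /arow e; split => //; clear -ge; lra.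
Qed.

(** [height] stays below A o0 o0 on the closed disk, so only the centre can carry an eigenvalue. *)
Lemma flat_spectrum_singleton A lam : flat_mx A ->
  A o2 o2 + hypot (A o2 o0) (A o2 o1) < A o0 o0 ->
  lorentz_spectrum A lam -> lam = A o2 o2.
Proof.
move=> fA lt; rewrite flat_lorentz_spectrum //.
have no x y : x ^+ 2 + y ^+ 2 <= 1 -> A o0 o0 <= height A x y -> False.
  move/(dot_le_hypot (A o2 o0) (A o2 o1)); rewrite ler_norml => /andP[_].
  by rewrite /height /arow; clear -lt; lra.
case=> [[x [y [xy _ le]]]|//|[_ [x [y [/ltW xy e]]]]]; exfalso.
  by apply: (@no x y) => //; rewrite xy.
by apply: (@no x y) => //; rewrite e.
Qed.

Lemma flat_mxN A : flat_mx A -> flat_mx (- A).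
Proof.
case=> h1 h2 h3 h4 h5; split; rewrite !mxE ?h1 ?h2 ?h3 ?h4 ?h5 ?oppr0 //.
Qed.

(** The strict inequality makes the interval of [flat_spectrum_interval] nondegenerate, for [A] and
    also for [- A]. *)
Definition thick_flat A : Prop := flat_mx A /\
  (A o2 o2 - A o0 o0) ^+ 2 < A o2 o0 ^+ 2 + A o2 o1 ^+ 2.

Lemma thick_flatN A : thick_flat A -> thick_flat (- A).
Proof.
case=> /flat_mxN fA lt; split=> //; rewrite !mxE !sqrrN -[X in X < _]sqrrN.
by congr (_ < _): lt; ring.
Qed.

Lemma thick_flat_infinite A : thick_flat A ->
  ~ exists s : seq R, forall lam, lorentz_spectrum A lam -> lam \in s.
Proof.
case=> fA lt [s hs]; have := lt; rewrite -norm_lt_hypot ltr_norml => /andP[dl dr].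
have [|t [t1 t2 /negP]] := @seq_misses_interval _ (A o0 o0)
   ((A o0 o0 + A o2 o2 + hypot (A o2 o0) (A o2 o1)) / 2) s.
  by clear -dl dr; lra.
apply; apply: hs; apply/flat_spectrum_interval => //; first exact: ltW.
by right; split; clear -t1 t2; lra.
Qed.

(** An infinite spectrum forces [B] to be flat and excludes the singleton case for [B] and [- B].
    Twice the maximum of the spectrum is then trace-like, a + d + N with N the norm of the last row;
    for the negatives it is -(a + d) + N, so the two together determine a + d and N. *)
Lemma thick_flat_spectrum_eq A B : thick_flat A ->
  lorentz_spectrum A = lorentz_spectrum B ->
  lorentz_spectrum (- A) = lorentz_spectrum (- B) ->
  [/\ flat_mx B, B o2 o0 ^+ 2 + B o2 o1 ^+ 2 = A o2 o0 ^+ 2 + A o2 o1 ^+ 2,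
    B o0 o0 + B o2 o2 = A o0 o0 + A o2 o2 &
    (B o2 o2 - B o0 o0) ^+ 2 <= B o2 o0 ^+ 2 + B o2 o1 ^+ 2].
Proof.
move=> tA eqAB eqNAB; have tNA := thick_flatN tA.
have fB : flat_mx B.
  apply: contrapT => /lorentz_spectrum_seq; rewrite -eqAB.
  exact: thick_flat_infinite.
have fNB := flat_mxN fB.
have lower C D : thick_flat C -> flat_mx D ->
    lorentz_spectrum C = lorentz_spectrum D ->
    D o0 o0 <= D o2 o2 + hypot (D o2 o0) (D o2 o1).
  move=> /thick_flat_infinite tC fD eqCD; rewrite leNgt; apply/negP => lt.
  apply: tC; exists [:: D o2 o2] => lam; rewrite eqCD inE => h.
  by apply/eqP; apply: flat_spectrum_singleton h.
have l1 := lower _ _ tA fB eqAB; have := lower _ _ tNA fNB eqNAB.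
rewrite !mxE hypotN => l2.
have sB : (B o2 o2 - B o0 o0) ^+ 2 <= B o2 o0 ^+ 2 + B o2 o1 ^+ 2.
  by rewrite -norm_le_hypot ler_norml; apply/andP; split; clear -l1 l2; lra.
have sNB : ((- B) o2 o2 - (- B) o0 o0) ^+ 2 <= (- B) o2 o0 ^+ 2 + (- B) o2 o1 ^+ 2.
  by rewrite !mxE !sqrrN -[X in X <= _]sqrrN; congr (_ <= _): sB; ring.
have upper C D : flat_mx C -> flat_mx D ->
    (C o2 o2 - C o0 o0) ^+ 2 <= C o2 o0 ^+ 2 + C o2 o1 ^+ 2 ->
    (D o2 o2 - D o0 o0) ^+ 2 <= D o2 o0 ^+ 2 + D o2 o1 ^+ 2 ->
    lorentz_spectrum C = lorentz_spectrum D ->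
    C o0 o0 + C o2 o2 + hypot (C o2 o0) (C o2 o1) <=
    D o0 o0 + D o2 o2 + hypot (D o2 o0) (D o2 o1).
  move=> fC fD sC sD eqCD.
  have : lorentz_spectrum C
      ((C o0 o0 + C o2 o2 + hypot (C o2 o0) (C o2 o1)) / 2).
    apply/flat_spectrum_interval => //; right.
    move: sC; rewrite -norm_le_hypot ler_norml => /andP[? ?].
    by split; lra.
  rewrite eqCD flat_spectrum_interval //.
  move: sD; rewrite -norm_le_hypot ler_norml => /andP[? ?].
  by case=> [|[_]]; lra.
case: tA tNA => fA /ltW sA [fNA /ltW sNA].
have h1 := upper _ _ fA fB sA sB eqAB.
have h2 := upper _ _ fB fA sB sA (esym eqAB).
have := upper _ _ fNA fNB sNA sNB eqNAB.
have := upper _ _ fNB fNA sNB sNA (esym eqNAB).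
rewrite !mxE !hypotN => h3 h4; split => //; last by clear -h1 h2 h3 h4; lra.
rewrite -!hypot_sqr; congr (_ ^+ 2).
by clear -h1 h2 h3 h4; lra.
Qed.
End Flat.

(** * Action of a preserver on flat matrices *)

Section FlatImage.
Variable R : realType.
Implicit Types (A B : 'M[R]_(2 + 1)) (a c d e lam : R).

Lemma thick_flat_interval_eq A B lam : thick_flat A ->
  lorentz_spectrum A = lorentz_spectrum B ->
  lorentz_spectrum (- A) = lorentz_spectrum (- B) ->
  let N := hypot (A o2 o0) (A o2 o1) in
  lam = A o2 o2 \/ A o0 o0 <= lam /\ 2 * lam <= A o0 o0 + A o2 o2 + N <->
  lam = B o2 o2 \/ B o0 o0 <= lam /\ 2 * lam <= B o0 o0 + B o2 o2 + N.
Proof.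
move=> tA e eN /=; have [fB nB _ sB] := thick_flat_spectrum_eq tA e eN.
have -> : hypot (A o2 o0) (A o2 o1) = hypot (B o2 o0) (B o2 o1).
  by rewrite /hypot nB.
have hB := @flat_spectrum_interval _ B lam fB sB; rewrite -hB -e.
case: tA => fA /ltW sA; rewrite flat_spectrum_interval //.
by rewrite /hypot nB.
Qed.

(** The first set has minimum [a], so [a'] and [d'] are at least [a], while [a] itself is [d'] or at
    least [a']; the sum settles the other value. The swap is harmless when a = d. *)
Lemma interval_spectrum_swap (a d a' d' M M' : R) :
  (forall lam, lam = d \/ a <= lam /\ 2 * lam <= M <->
     lam = d' \/ a' <= lam /\ 2 * lam <= M') ->
  a <= d -> 2 * d < M -> a' + d' = a + d -> M' = M ->
  a' = a /\ d' = d \/ a' = d /\ d' = a.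
Proof.
move=> h ad dN s eM.
have d'a : a <= d' by case: (h d') => _ []; [left|lra|lra].
have a'a : a <= a' by case: (h a') => _ []; [right; split; lra|lra|lra].
case: (h a) => [] []; [right; split; lra|lra|].
by move=> [le _] _; left; lra.
Qed.

Definition flat3 (a c e d : R) : 'M[R]_(2 + 1) :=
  a *: (delta_mx o0 o0 + delta_mx o1 o1) + c *: delta_mx o2 o0
    + e *: delta_mx o2 o1 + d *: delta_mx o2 o2.

Lemma flat3_flat a c e d : flat_mx (flat3 a c e d).
Proof. by split; rewrite !mxE /=; ring. Qed.

Lemma flat3E a c e d : [/\ flat3 a c e d o0 o0 = a, flat3 a c e d o2 o0 = c,
  flat3 a c e d o2 o1 = e & flat3 a c e d o2 o2 = d].
Proof. by split; rewrite !mxE /=; ring. Qed.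

Lemma flat_mxE A : flat_mx A ->
  A = flat3 (A o0 o0) (A o2 o0) (A o2 o1) (A o2 o2).
Proof.
case=> h1 h2 h3 h4 h5; apply/matrixP; apply: ord3P; apply: ord3P;
  by rewrite !mxE /= ?h1 ?h2 ?h3 ?h4 -?h5; ring.
Qed.

Lemma flat_mxD A B : flat_mx A -> flat_mx B -> flat_mx (A + B).
Proof.
case=> a1 a2 a3 a4 a5 [b1 b2 b3 b4 b5].
by split; rewrite !mxE ?a1 ?a2 ?a3 ?a4 ?a5 ?b1 ?b2 ?b3 ?b4 ?b5 ?addr0.
Qed.

Lemma flat_mxZ k A : flat_mx A -> flat_mx (k *: A).
Proof.
case=> a1 a2 a3 a4 a5.
by split; rewrite !mxE ?a1 ?a2 ?a3 ?a4 ?a5 ?mulr0.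
Qed.

Variable phi : {linear 'M[R]_(2 + 1) -> 'M[R]_(2 + 1)}.
Hypothesis hphi : lorentz_spectrum_preserver phi.

Lemma preserver_thick a c e d : (d - a) ^+ 2 < c ^+ 2 + e ^+ 2 ->
  let B := phi (flat3 a c e d) in
  [/\ flat_mx B, B o2 o0 ^+ 2 + B o2 o1 ^+ 2 = c ^+ 2 + e ^+ 2,
      B o0 o0 + B o2 o2 = a + d &
      forall lam, let N := hypot c e in
        lam = d \/ a <= lam /\ 2 * lam <= a + d + N <->
        lam = B o2 o2 \/ B o0 o0 <= lam /\ 2 * lam <= B o0 o0 + B o2 o2 + N].
Proof.
move=> lt B; have [E0 E1 E2 E3] := flat3E a c e d.
have tA : thick_flat (flat3 a c e d).
  by split; [exact: flat3_flat|rewrite E0 E1 E2 E3].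
have e1 : lorentz_spectrum (flat3 a c e d) = lorentz_spectrum B by rewrite hphi.
have e2 : lorentz_spectrum (- flat3 a c e d) = lorentz_spectrum (- B).
  by rewrite /B -raddfN hphi.
have [fB nB sB _] := thick_flat_spectrum_eq tA e1 e2.
split=> //; rewrite ?nB ?sB ?E0 ?E1 ?E2 ?E3 //.
move=> lam; have := @thick_flat_interval_eq _ _ lam tA e1 e2.
by rewrite E0 E1 E2 E3 sB E0 E3.
Qed.

Lemma preserver_flat3 a c e d :
  phi (flat3 a c e d) = a *: phi (flat3 1 0 0 0) + c *: phi (flat3 0 1 0 0)
    + e *: phi (flat3 0 0 1 0) + d *: phi (flat3 0 0 0 1).
Proof.
rewrite -!linearZ -!linearD; congr (phi _).
by rewrite /flat3 !scale0r !scale1r !addr0 !add0r.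
Qed.

(** Spectra are compared on thick matrices only, so every test has |d - a| < |(c, e)|. The norms of
    the last rows for (c, e) = (1, 0), (0, 1), (1, 1) make the columns of [Q] orthonormal; the
    spectra and the sums a + d give the diagonal entries. *)
Lemma preserver_flat : exists2 Q : 'M[R]_2, Q^T *m Q = 1%:M &
  forall a c e d, phi (flat3 a c e d) =
    flat3 a (Q 0 0 * c + Q 0 1 * e) (Q 1 0 * c + Q 1 1 * e) d.
Proof.
have T := preserver_thick.
have h0 : hypot 1 0 = 1 :> R by rewrite /hypot expr1n expr0n addr0 sqrtr1.
have h1 : hypot 0 1 = 1 :> R by rewrite /hypot expr1n expr0n add0r sqrtr1.
have F := preserver_flat3.
have [|f1 n1 s1 i1] := T 0 1 0 0; first by rewrite !expr2; lra.
have [|f2 n2 s2 i2] := T 0 0 1 0; first by rewrite !expr2; lra.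
have [|_ n12 _ _] := T 0 1 1 0; first by rewrite !expr2; lra.
have [|fi ni si ii] := T (1/2) 1 0 0; first by rewrite !expr2; lra.
have [|_ ni' _ _] := T (- (1/2)) 1 0 0; first by rewrite !expr2; lra.
have [|fd nd sd id] := T 0 1 0 (1/2); first by rewrite !expr2; lra.
have [|_ nd' sd' id'] := T 0 1 0 (- (1/2)); first by rewrite !expr2; lra.
have [|_ _ sid iid] := T (1/2) 1 0 (1/2); first by rewrite !expr2; lra.
have fI : flat_mx (phi (flat3 1 0 0 0)).
  (* [flat3 1 0 0 0] is not thick; its image is recovered from two thick tests. *)
  have -> : phi (flat3 1 0 0 0) = 2 *: phi (flat3 (1/2) 1 0 0)
              + (- 2) *: phi (flat3 0 1 0 0).
    by rewrite (F (1/2)) !scale0r !addr0 !scalerDr !scalerA; apply/matrixP => i j;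
      rewrite !mxE; field.
  by apply: flat_mxD; apply: flat_mxZ.
have fD : flat_mx (phi (flat3 0 0 0 1)).
  have -> : phi (flat3 0 0 0 1) = 2 *: phi (flat3 0 1 0 (1/2))
              + (- 2) *: phi (flat3 0 1 0 0).
    by rewrite (F _ _ _ (1/2)) !scale0r !addr0 !scalerDr !scalerA; apply/matrixP => i j;
      rewrite !mxE; field.
  by apply: flat_mxD; apply: flat_mxZ.
move: n12 ni si ii ni' nd sd id nd' sd' id' sid iid {fi fd}.
rewrite (F 0 1 1 0) (F (1/2) 1 0 0) (F (- (1/2)) 1 0 0) (F 0 1 0 (1/2))
  (F 0 1 0 (- (1/2))) (F (1/2) 1 0 (1/2)) {T}.
rewrite !scale0r !addr0 !add0r !scale1r.
move: F f1 f2 fI fD n1 n2 s1 s2 i1 i2.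
move: (phi (flat3 1 0 0 0)) (phi (flat3 0 1 0 0)) (phi (flat3 0 0 1 0))
  (phi (flat3 0 0 0 1)) => PI P1 P2 PD F f1 f2 fI fD n1 n2 s1 s2 i1 i2.
rewrite !mxE h0 => n12 ni si ii ni' nd sd id nd' sd' id' sid iid.
have [d1 a1] : P1 o2 o2 = 0 /\ P1 o0 o0 = 0.
  move: i1; rewrite h0 => i1; clear -s1 i1.
  by have [||||[? ?]|[? ?]] := interval_spectrum_swap i1; [lra..|split; lra|split; lra].
have [d2 a2] : P2 o2 o2 = 0 /\ P2 o0 o0 = 0.
  move: i2; rewrite h1 => i2; clear -s2 i2.
  by have [||||[? ?]|[? ?]] := interval_spectrum_swap i2; [lra..|split; lra|split; lra].
have aI : PI o0 o0 + PD o0 o0 = 1.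
  clear -sid a1 d1 iid.
  by have [||||[? ?]|[? ?]] := interval_spectrum_swap iid; lra.
have [aD dD] : PD o0 o0 = 0 /\ PD o2 o2 = 1.
  clear -sd a1 d1 id id'.
  have [||||[? ?]|[h h']] := interval_spectrum_swap id; [lra..|split; lra|].
  (* In the swapped case the image for d = -1/2 would have spectrum [-1/2, 1/4], whereas the
     original has only -1/2 and [0, 1/4]. *)
  have [_] := id' (- (1/4)).
  have -> : PD o0 o0 = 1 by clear -h a1; lra.
  have -> : PD o2 o2 = 0 by clear -h' d1; lra.
  rewrite a1 d1 => h2; exfalso.
  have {h2} [|h2|[h2 _]] := h2; [right; split; lra|lra|lra].
have {}aI : PI o0 o0 = 1 by clear -aI aD; lra.
have dI : PI o2 o2 = 0 by clear -si aI a1 d1; lra.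
(* The last rows of [P1] + [PI] / 2 and [P1] - [PI] / 2 both have the norm of that of [P1]; by the
   parallelogram identity the last row of [PI] has zero first two entries. *)
have [cI eI] : PI o2 o0 = 0 /\ PI o2 o1 = 0.
  by apply: sumsqr_le0; clear -ni ni' n1; lra.
have [cD eD] : PD o2 o0 = 0 /\ PD o2 o1 = 0.
  by apply: sumsqr_le0; clear -nd nd' n1; lra.
pose q (i j : 'I_2) : R := (if j == 0 then P1 else P2) o2 (if i == 0 then o0 else o1).
exists (\matrix_(i, j) q i j) => [|a c e d].
  apply/matrixP => i j; rewrite !mxE !big_ord_recl big_ord0 !mxE /q /=.
  case: i => [[|[|//]] ?]; case: j => [[|[|//]] ?] /=; clear -n1 n2 n12; lra.
rewrite F (flat_mxE f1) (flat_mxE f2) (flat_mxE fI) (flat_mxE fD).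
rewrite a1 d1 a2 d2 aI dI cI eI aD dD cD eD !mxE /q /=.
by apply/matrixP => i j; rewrite !mxE; ring.
Qed.
End FlatImage.

(** * Isolating a boundary eigenvector *)

Section Quadratic.
Variable R : realType.

Definition quad (a b c d e g x y : R) : R :=
  a * x ^+ 2 + b * (x * y) + c * y ^+ 2 + d * x + e * y + g.

Lemma unit_coord_le1 (x y : R) : x ^+ 2 + y ^+ 2 <= 1 -> `|x| <= 1 /\ `|y| <= 1.
Proof.
move=> xy; have x0 := sqr_ge0 x; have y0 := sqr_ge0 y.
by split; rewrite -(ler_sqr (x := `|_|)) ?nnegrE ?real_normK ?num_real // expr1n; lra.
Qed.

Lemma norm_mul_le (a x k : R) : `|x| <= k -> `|a * x| <= `|a| * k.
Proof. by move=> h; rewrite normrM ler_wpM2l. Qed.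

Lemma affine_bounded (a b c x y : R) : x ^+ 2 + y ^+ 2 <= 1 ->
  `|a * x + b * y + c| <= `|a| + `|b| + `|c|.
Proof.
case/unit_coord_le1 => /(norm_mul_le a) hx /(norm_mul_le b) hy.
have := ler_normD (a * x + b * y) c; have := ler_normD (a * x) (b * y).
lra.
Qed.

Lemma quad_bounded a b c d e g : exists K, forall x y,
  x ^+ 2 + y ^+ 2 = 1 -> `|quad a b c d e g x y| <= K.
Proof.
exists (`|a| + `|b| + `|d| + (`|b| + `|c| + `|e|) + `|g|) => x y xy.
have -> : quad a b c d e g x y =
  (a * x + 0 * y + d) * x + (b * x + c * y + e) * y + g by rewrite /quad; ring.
have le1 : x ^+ 2 + y ^+ 2 <= 1 by rewrite xy.
have [hx hy] := unit_coord_le1 le1.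
have := ler_normD ((a * x + 0 * y + d) * x + (b * x + c * y + e) * y) g.
have := ler_normD ((a * x + 0 * y + d) * x) ((b * x + c * y + e) * y).
have := norm_mul_le (a * x + 0 * y + d) hx.
have := norm_mul_le (b * x + c * y + e) hy.
have := affine_bounded a 0 d le1; have := affine_bounded b c e le1.
have := normr_ge0 b; rewrite normr0; lra.
Qed.

(** On the circle 1 - (p x + q y) is half the squared distance; the bound is stated with it because
    a tilt controls this quantity. *)
Lemma quad_lipschitz a b c d e g : exists2 K, 0 <= K & forall x y p q,
  x ^+ 2 + y ^+ 2 = 1 -> p ^+ 2 + q ^+ 2 = 1 ->
  (quad a b c d e g x y - quad a b c d e g p q) ^+ 2
    <= K * (1 - (p * x + q * y)).
Proof.
pose U0 : R := `|a| + `|b| + `|d| + (`|a| + `|(0 : R)| + `|(0 : R)|).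
pose V0 : R := `|b| + `|c| + `|e| + (`|(0 : R)| + `|c| + `|(0 : R)|).
exists ((U0 ^+ 2 + V0 ^+ 2) * 2).
  by rewrite mulr_ge0 // addr_ge0 ?sqr_ge0.
move=> x y p q xy pq.
pose U := a * x + b * y + d + (a * p + 0 * q + 0).
pose V := b * p + c * q + e + (0 * x + c * y + 0).
have lx : x ^+ 2 + y ^+ 2 <= 1 by rewrite xy.
have lp : p ^+ 2 + q ^+ 2 <= 1 by rewrite pq.
have hU : U ^+ 2 <= U0 ^+ 2.
  rewrite -(real_normK (num_real U)) lerXn2r ?nnegrE ?addr_ge0 //.
  by rewrite (le_trans (ler_normD _ _)) // lerD // affine_bounded.
have hV : V ^+ 2 <= V0 ^+ 2.
  rewrite -(real_normK (num_real V)) lerXn2r ?nnegrE ?addr_ge0 //.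
  by rewrite (le_trans (ler_normD _ _)) // lerD // affine_bounded.
(* The difference factors through x - p and y - q with affine cofactors, bounded on the disk;
   Cauchy-Schwarz then finishes. *)
have -> : quad a b c d e g x y - quad a b c d e g p q =
    (x - p) * U + (y - q) * V by rewrite /quad /U /V; ring.
have dE : (x - p) ^+ 2 + (y - q) ^+ 2 = 2 * (1 - (p * x + q * y)).
  by transitivity (x ^+ 2 + y ^+ 2 + (p ^+ 2 + q ^+ 2)
    - 2 * (p * x + q * y)); [ring|rewrite xy pq; ring].
rewrite -mulrA -dE.
apply: le_trans (_ : (U ^+ 2 + V ^+ 2) * ((x - p) ^+ 2 + (y - q) ^+ 2) <= _).
  rewrite -subr_ge0; have -> : (U ^+ 2 + V ^+ 2) * ((x - p) ^+ 2 + (y - q) ^+ 2)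
    - ((x - p) * U + (y - q) * V) ^+ 2 = ((x - p) * V - (y - q) * U) ^+ 2 by ring.
  exact: sqr_ge0.
by rewrite ler_wpM2r ?lerD // addr_ge0 ?sqr_ge0.
Qed.

Lemma le0_of_scaled_bound (u C : R) : (forall t, 0 < t -> u * t <= C) -> u <= 0.
Proof.
move=> h; rewrite leNgt; apply/negP => u0.
have := h ((`|C| + 1) / u); rewrite divr_gt0 ?ltr_wpDl // => /(_ isT).
rewrite mulrC divfK ?gt_eqF //; have := ler_norm C; lra.
Qed.
End Quadratic.

(** * Tilting the last row *)

Section Penalty.
Variable R : realType.
Implicit Types (A B : 'M[R]_(2 + 1)) (x y p q lam : R).

Definition gap A x y : R := radial A x y + height A x y.

Lemma angular_quad A x y : angular A x y = quad (A o1 o0) (A o1 o1 - A o0 o0)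
  (- A o0 o1) (A o1 o2) (- A o0 o2) 0 x y.
Proof. by rewrite /angular /arow /quad; ring. Qed.

Lemma gap_quad A x y : gap A x y = quad (A o0 o0) (A o0 o1 + A o1 o0)
  (A o1 o1) (A o0 o2 + A o2 o0) (A o1 o2 + A o2 o1) (A o2 o2) x y.
Proof. by rewrite /gap /radial /height /arow /quad; ring. Qed.

Lemma arow_tilt A c e d x y : let B := A + flat3 0 c e d in
  [/\ radial B x y = radial A x y, angular B x y = angular A x y &
      height B x y = height A x y + c * x + e * y + d].
Proof.
by rewrite /radial /angular /height /arow /flat3 !mxE /=; split; ring.
Qed.

(* The tilt adds [t * (p * x + q * y)] to twice the Lorentz eigenvalue carried
   by [(x, y)], which favours [(p, q)]; a large [d] discards the interior
   eigenvectors. *)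
Lemma tilted_spectrum A B p q t :
  (forall c e d, lorentz_spectrum (A + flat3 0 c e d) =
                 lorentz_spectrum (B + flat3 0 c e d)) ->
  p ^+ 2 + q ^+ 2 = 1 -> angular A p q = 0 -> 0 < t ->
  exists x y, [/\ x ^+ 2 + y ^+ 2 = 1, angular B x y = 0 &
    t * (1 - (p * x + q * y)) = gap B x y - gap A p q].
Proof.
move=> eqs pq ang t0; pose M := `|B o2 o0| + `|B o2 o1| + `|B o2 o2|.
(* So large that (p, q) satisfies [radial] <= [height] for the tilted [A], and that an interior
   eigenvector of the tilted [B] would have eigenvalue at least d - M - t > lam. *)
pose d := `|radial A p q| + `|height A p q| + 3 * t + 2 * M + 1.
pose lam := (gap A p q + t + d) / 2.
have M0 : 0 <= M by rewrite !addr_ge0.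
have hr := ler_norm (radial A p q); have hh := ler_norm (height A p q).
have hr' := ler_norm (- radial A p q); have hh' := ler_norm (- height A p q).
rewrite normrN in hr'; rewrite normrN in hh'.
have : lorentz_spectrum (A + flat3 0 (t * p) (t * q) d) lam.
  apply/lorentz_spectrum3P; left; exists p, q.
  have [-> -> ->] := arow_tilt A (t * p) (t * q) d p q.
  have e : t * p * p + t * q * q = t by rewrite -[RHS]mulr1 -pq; ring.
  split=> //; first by rewrite /lam /gap -[in RHS](addrA (height _ _ _)) e; field.
  by rewrite -(addrA (height _ _ _)) e /d; lra.
rewrite eqs lorentz_spectrum3P.
case=> [[x [y [xy]]]|[x [y [/ltW xy _ _]]]].
  have [-> -> ->] := arow_tilt B (t * p) (t * q) d x y.
  move=> angB lamE _; exists x, y; split => //; move: lamE.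
  rewrite /lam /gap; lra.
have [_ _ ->] := arow_tilt B (t * p) (t * q) d x y; move=> lamE; exfalso.
have := affine_bounded (B o2 o0) (B o2 o1) (B o2 o2) xy.
rewrite -/M -[X in `|X|]/(height B x y) ler_norml => /andP[hB _].
have : `|p * x + q * y| <= hypot p q by exact: dot_le_hypot.
rewrite /hypot pq sqrtr1 ler_norml => /andP[hd _].
have : t * -1 <= t * (p * x + q * y) by rewrite ler_pM2l.
move: lamE; rewrite /lam /d /gap; lra.
Qed.

(** As t grows, [tilted_spectrum] yields zeros (x, y) of [angular B] with [gap B x y] >= [gap A p q]
    and t (1 - (p x + q y)) bounded. They converge to (p, q), and both properties pass to the limit;
    [lip] provides the rate for either function. *)
Lemma tilt_angular_gap A B p q :
  (forall c e d, lorentz_spectrum (A + flat3 0 c e d) =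
                 lorentz_spectrum (B + flat3 0 c e d)) ->
  p ^+ 2 + q ^+ 2 = 1 -> angular A p q = 0 ->
  angular B p q = 0 /\ gap A p q <= gap B p q.
Proof.
move=> eqs pq ang.
have [C hC] : exists C, forall x y, x ^+ 2 + y ^+ 2 = 1 -> `|gap B x y| <= C.
  have [C hC] := quad_bounded (B o0 o0) (B o0 o1 + B o1 o0)
    (B o1 o1) (B o0 o2 + B o2 o0) (B o1 o2 + B o2 o1) (B o2 o2).
  by exists C => x y xy; rewrite gap_quad hC.
have lip h : (exists2 K, 0 <= K & forall x y p q, x ^+ 2 + y ^+ 2 = 1 ->
      p ^+ 2 + q ^+ 2 = 1 -> (h x y - h p q) ^+ 2 <= K * (1 - (p * x + q * y))) ->
    exists D, forall t, 0 < t -> exists x y, [/\ x ^+ 2 + y ^+ 2 = 1,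
      angular B x y = 0, gap A p q <= gap B x y &
      (h x y - h p q) ^+ 2 * t <= D].
  case=> K K0 hK; exists (K * (C + `|gap A p q|)) => t t0.
  have [x [y [xy angB e]]] := tilted_spectrum eqs pq ang t0.
  exists x, y; split => //.
    rewrite -subr_ge0 -e mulr_ge0 ?(ltW t0) // subr_ge0.
    have : `|p * x + q * y| <= hypot p q by apply: dot_le_hypot; rewrite xy.
    by rewrite /hypot pq sqrtr1 => /(le_trans (ler_norm _)).
  apply: le_trans (_ : K * (1 - (p * x + q * y)) * t <= _).
    by rewrite ler_pM2r // hK.
  rewrite -mulrA ler_wpM2l // mulrC e.
  have := hC _ _ xy; have := ler_norm (gap B x y).
  have := ler_norm (- gap A p q); rewrite normrN; lra.
split.
- have [|D hD] := lip (angular B).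
    have [K K0 hK] := quad_lipschitz (B o1 o0) (B o1 o1 - B o0 o0)
      (- B o0 o1) (B o1 o2) (- B o0 o2) 0.
    by exists K => // x y u v xy uv; rewrite !angular_quad hK.
  apply/eqP; rewrite -sqrf_eq0 eq_le sqr_ge0 andbT.
  apply: (@le0_of_scaled_bound _ _ D) => t t0.
  by have [x [y [_ -> _]]] := hD _ t0; rewrite sub0r sqrrN.
- have [|D hD] := lip (gap B).
    have [K K0 hK] := quad_lipschitz (B o0 o0) (B o0 o1 + B o1 o0)
      (B o1 o1) (B o0 o2 + B o2 o0) (B o1 o2 + B o2 o1) (B o2 o2).
    by exists K => // x y u v xy uv; rewrite !gap_quad hK.
  rewrite leNgt; apply/negP; rewrite -subr_gt0 => lt.
  have : (gap A p q - gap B p q) ^+ 2 <= 0.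
    apply: (@le0_of_scaled_bound _ _ D) => t t0.
    have [x [y [_ _ le]]] := hD _ t0; apply: le_trans.
    rewrite ler_pM2r // lerXn2r ?nnegrE ?(ltW lt) ?lerD2r //.
    by rewrite subr_ge0 (le_trans _ le) // -subr_ge0 ltW.
  by rewrite leNgt exprn_gt0.
Qed.
End Penalty.

(** * Preservers fixing flat matrices *)

Section CircleQuad.
Variable R : realType.

(** Modulo x^2 + y^2 - 1, [quad] has five free coefficients, and five rational points of the circle
    determine them. *)
Lemma circle_quad_eq0 (a b c d e g : R) :
  (forall x y, x ^+ 2 + y ^+ 2 = 1 -> quad a b c d e g x y = 0) ->
  [/\ a = c, b = 0, d = 0, e = 0 & a + g = 0].
Proof.
rewrite /quad => h.
have [] : 1 ^+ 2 + 0 ^+ 2 = 1 :> R /\ 0 ^+ 2 + 1 ^+ 2 = 1 :> R by split; ring.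
move=> /h + /h.
have [] : (- 1) ^+ 2 + 0 ^+ 2 = 1 :> R /\ 0 ^+ 2 + (- 1) ^+ 2 = 1 :> R by split; ring.
move=> /h + /h.
have /h : (3 / 5) ^+ 2 + (4 / 5) ^+ 2 = 1 :> R by field.
by clear h => h1 h2 h3 h4 h5; split; lra.
Qed.

(* The product of a trigonometric polynomial of degree 2 with [cos (2 theta)]
   has degree 4 unless the polynomial is constant; twelve rational points of
   the circle detect this. *)
Lemma circle_quad_cos2 (a b c d e g a' b' c' d' e' g' : R) :
  (forall x y, x ^+ 2 + y ^+ 2 = 1 ->
     quad a' b' c' d' e' g' x y = quad a b c d e g x y * (x ^+ 2 - y ^+ 2)) ->
  [/\ a = c, b = 0, d = 0 & e = 0].
Proof.
rewrite /quad => h.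
have u0 (s : R) : s ^+ 2 = 1 -> s ^+ 2 + 0 ^+ 2 = 1 by move=> ->; ring.
have u1 (s : R) : s ^+ 2 = 1 -> 0 ^+ 2 + s ^+ 2 = 1 by move=> ->; ring.
have u2 (s t : R) : s ^+ 2 = 1 -> t ^+ 2 = 1 ->
  (3 / 5 * s) ^+ 2 + (4 / 5 * t) ^+ 2 = 1 by rewrite !exprMn => -> ->; field.
have u3 (s t : R) : s ^+ 2 = 1 -> t ^+ 2 = 1 ->
  (4 / 5 * s) ^+ 2 + (3 / 5 * t) ^+ 2 = 1 by rewrite !exprMn => -> ->; field.
have p1 : 1 ^+ 2 = 1 :> R by ring.
have n1 : (- 1) ^+ 2 = 1 :> R by ring.
have := h _ _ (u0 _ p1); have := h _ _ (u0 _ n1).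
have := h _ _ (u1 _ p1); have := h _ _ (u1 _ n1).
have := h _ _ (u2 _ _ p1 p1); have := h _ _ (u2 _ _ p1 n1).
have := h _ _ (u2 _ _ n1 p1); have := h _ _ (u2 _ _ n1 n1).
have := h _ _ (u3 _ _ p1 p1); have := h _ _ (u3 _ _ p1 n1).
have := h _ _ (u3 _ _ n1 p1); have := h _ _ (u3 _ _ n1 n1).
clear h u0 u1 u2 u3 p1 n1 => h1 h2 h3 h4 h5 h6 h7 h8 h9 h10 h11 h12.
split; lra.
Qed.
End CircleQuad.

Section FlatFixing.
Variable R : realType.
Implicit Types (A B : 'M[R]_(2 + 1)) (x y p q k : R).

Lemma angularBZ A B k x y :
  angular (A - k *: B) x y = angular A x y - k * angular B x y.
Proof. by rewrite /angular /arow !mxE; ring. Qed.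

Lemma gapBZ A B k x y : gap (A - k *: B) x y = gap A x y - k * gap B x y.
Proof. by rewrite /gap /radial /height /arow !mxE; ring. Qed.

Lemma angularN A x y : angular (- A) x y = - angular A x y.
Proof. by rewrite /angular /arow !mxE; ring. Qed.

Lemma gapN A x y : gap (- A) x y = - gap A x y.
Proof. by rewrite /gap /radial /height /arow !mxE; ring. Qed.

Variable psi : {linear 'M[R]_(2 + 1) -> 'M[R]_(2 + 1)}.
Hypothesis hpsi : lorentz_spectrum_preserver psi.
Hypothesis psi_flat : forall a c e d, psi (flat3 a c e d) = flat3 a c e d.

(** [psi] fixes the tilts, so [tilt_angular_gap] applies to [A] and to [- A], which gives the two
    inequalities between the gaps. *)
Lemma fix_flat_angular_gap A p q : p ^+ 2 + q ^+ 2 = 1 -> angular A p q = 0 ->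
  angular (psi A) p q = 0 /\ gap (psi A) p q = gap A p q.
Proof.
move=> pq ang.
have eqs B c e d : lorentz_spectrum (B + flat3 0 c e d) =
    lorentz_spectrum (psi B + flat3 0 c e d).
  by rewrite -[flat3 _ _ _ _ in RHS]psi_flat -raddfD hpsi.
have [-> le] := tilt_angular_gap (eqs A) pq ang; split=> //.
have [|_] := tilt_angular_gap (eqs (- A)) pq; first by rewrite angularN ang oppr0.
by rewrite raddfN !gapN lerN2 => ge; apply/eqP; rewrite eq_le ge le.
Qed.

(** Its [angular] is 1 on the circle, so subtracting [angular A p q] times it from [A] creates a
    zero at any prescribed (p, q). *)
Definition quarter_turn : 'M[R]_(2 + 1) := delta_mx o1 o0 - delta_mx o0 o1.

Lemma angular_quarter_turn x y : angular quarter_turn x y = x ^+ 2 + y ^+ 2.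
Proof. by rewrite /angular /arow /quarter_turn !mxE /=; ring. Qed.

Definition defect A := psi A - A.

Lemma defect_angular_gap A p q : p ^+ 2 + q ^+ 2 = 1 ->
  angular (defect A) p q = angular (defect quarter_turn) p q * angular A p q /\
  gap (defect A) p q = gap (defect quarter_turn) p q * angular A p q.
Proof.
move=> pq; have [|] := @fix_flat_angular_gap (A - angular A p q *: quarter_turn) p q pq.
  by rewrite angularBZ angular_quarter_turn pq mulr1 subrr.
have -> k : psi (A - k *: quarter_turn) = psi A - k *: psi quarter_turn.
  by rewrite raddfB; congr (_ - _); exact: linearZ_LR.
rewrite !angularBZ !gapBZ.
have defE B : defect B = psi B - 1 *: B by rewrite scale1r.
rewrite !defE !angularBZ !gapBZ angular_quarter_turn pq => ea eg.
by split; lra.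
Qed.

Lemma defect_angular_gap0 A p q : p ^+ 2 + q ^+ 2 = 1 ->
  angular (defect A) p q = 0 /\ gap (defect A) p q = 0.
Proof.
move=> pq; have [-> ->] := defect_angular_gap A pq.
suff [-> ->] : angular (defect quarter_turn) p q = 0 /\
    gap (defect quarter_turn) p q = 0 by rewrite !mul0r.
have D := defect_angular_gap; set J := defect quarter_turn in D *.
(* [angular C] is cos (2 theta) on the circle, so the functions of [J] times cos (2 theta) still
   have degree 2; hence they are constant. *)
pose C : 'M[R]_(2 + 1) := delta_mx o1 o0 + delta_mx o0 o1.
have angC x y : angular C x y = x ^+ 2 - y ^+ 2.
  by rewrite /angular /arow /C !mxE /=; ring.
have DC x y (xy : x ^+ 2 + y ^+ 2 = 1) := D C x y xy.
have [c1 c2 c3 c4] :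
   [/\ J o1 o0 = - J o0 o1, J o1 o1 - J o0 o0 = 0, J o1 o2 = 0 & - J o0 o2 = 0].
  apply: circle_quad_cos2 => x y /DC[+ _].
  by rewrite angC !angular_quad; apply.
have [g1 g2 g3 g4] : [/\ J o0 o0 = J o1 o1, J o0 o1 + J o1 o0 = 0,
    J o0 o2 + J o2 o0 = 0 & J o1 o2 + J o2 o1 = 0].
  apply: circle_quad_cos2 => x y /DC[_ +].
  by rewrite angC !gap_quad; apply.
have constA x y : x ^+ 2 + y ^+ 2 = 1 -> angular J x y = J o1 o0.
  move=> xy; rewrite angular_quad c2 c3 c4 -c1 /quad -[RHS]mulr1 -xy; ring.
have constG x y : x ^+ 2 + y ^+ 2 = 1 -> gap J x y = J o0 o0 + J o2 o2.
  move=> xy; rewrite gap_quad g2 g3 g4 -g1 /quad.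
  by transitivity (J o0 o0 * (x ^+ 2 + y ^+ 2) + J o2 o2); [ring|rewrite xy mulr1].
rewrite constA // constG //.
(* [angular S] is - sin (2 theta), so both functions of [T] are constant multiples of it. They share
   entries of [T]: [gap] makes the first two diagonal entries equal, killing the constant of
   [angular]; [angular] kills the planar off-diagonal entries, hence the constant of [gap]. *)
pose S : 'M[R]_(2 + 1) := delta_mx o0 o0 - delta_mx o1 o1.
have angS x y : angular S x y = - 2 * (x * y).
  by rewrite /angular /arow /S !mxE /=; ring.
set T := defect S in D *.
have [] : [/\ T o1 o0 = - T o0 o1, T o1 o1 - T o0 o0 + 2 * J o1 o0 = 0,
    T o1 o2 = 0, - T o0 o2 = 0 & T o1 o0 + 0 = 0].
  apply: circle_quad_eq0 => x y xy; have [+ _] := D S x y xy.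
  rewrite constA // angS angular_quad /quad; lra.
have [] : [/\ T o0 o0 = T o1 o1, T o0 o1 + T o1 o0 + 2 * (J o0 o0 + J o2 o2) = 0,
    T o0 o2 + T o2 o0 = 0, T o1 o2 + T o2 o1 = 0 & T o0 o0 + T o2 o2 = 0].
  apply: circle_quad_eq0 => x y xy; have [_ +] := D S x y xy.
  rewrite constG // angS gap_quad /quad; lra.
by move=> t1 t2 _ _ _ t3 t4 _ _ _; clear -t1 t2 t3 t4; split; lra.
Qed.

Lemma defect_scalar A : exists k, psi A = A + flat3 k 0 0 (- k).
Proof.
have [a1 a2 a3 a4 a5] : [/\ (defect A) o1 o0 = - (defect A) o0 o1,
    (defect A) o1 o1 - (defect A) o0 o0 = 0, (defect A) o1 o2 = 0,
    - (defect A) o0 o2 = 0 & (defect A) o1 o0 + 0 = 0].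
  apply: circle_quad_eq0 => x y xy; rewrite -angular_quad.
  by have [] := defect_angular_gap0 A xy.
have [_ b2 b3 b4 b5] : [/\ (defect A) o0 o0 = (defect A) o1 o1,
    (defect A) o0 o1 + (defect A) o1 o0 = 0, (defect A) o0 o2 + (defect A) o2 o0 = 0,
    (defect A) o1 o2 + (defect A) o2 o1 = 0 & (defect A) o0 o0 + (defect A) o2 o2 = 0].
  apply: circle_quad_eq0 => x y xy; rewrite -gap_quad.
  by have [] := defect_angular_gap0 A xy.
exists (defect A o0 o0); apply/eqP; rewrite addrC -subr_eq; apply/eqP.
rewrite -/(defect A); move: (defect A) a1 a2 a3 a4 a5 b2 b3 b4 b5 => B *.
by apply/matrixP; apply: ord3P; apply: ord3P; rewrite !mxE /=; lra.
Qed.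

(** Adding [flat3 k 0 0 (- k)] keeps [angular] free of zeros, so the eigenvalue 0 of [psi A] has an
    interior eigenvector, where [height] is -k. *)
Lemma fix_flat_interior A x y : x ^+ 2 + y ^+ 2 < 1 ->
  arow A o0 x y = 0 -> arow A o1 x y = 0 ->
  (forall p q, height A p q = 0) ->
  (forall p q, p ^+ 2 + q ^+ 2 = 1 -> angular A p q != 0) ->
  psi A = A.
Proof.
move=> xy r0 r1 h0 nang; have [k psiA] := defect_scalar A.
suff k0 : k = 0.
  by rewrite psiA k0 /flat3 oppr0 !scale0r !addr0.
have : lorentz_spectrum A 0.
  by apply/lorentz_spectrum3P; right; exists x, y; rewrite r0 r1 h0 !mul0r.
rewrite -hpsi psiA lorentz_spectrum3P.
have angE p q : angular (A + flat3 k 0 0 (- k)) p q = angular A p q.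
  by rewrite /angular /arow /flat3 !mxE /=; ring.
have hE p q : height (A + flat3 k 0 0 (- k)) p q = height A p q - k.
  by rewrite /height /arow /flat3 !mxE /=; ring.
case=> [[p [q [/nang/eqP + ang]]]|[p [q [_ _ _]]]].
  by rewrite -angE ang.
by rewrite hE h0 sub0r => /eqP; rewrite oppr_eq0 => /eqP.
Qed.

Lemma fix_flat_id A : psi A = A.
Proof.
have F (B : 'M[R]_(2 + 1)) x y : x ^+ 2 + y ^+ 2 < 1 ->
    arow B o0 x y = 0 -> arow B o1 x y = 0 ->
    (forall p q, height B p q = 0) ->
    (forall p q, p ^+ 2 + q ^+ 2 = 1 -> 0 < angular B p q) -> psi B = B.
  by move=> xy e0 e1 h ang; apply: (fix_flat_interior xy) => // p q /ang; case: ltgtP.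
(* Small perturbations of the quarter turn keep [angular] positive; together with the flat matrices
   they span the whole space. *)
have FJ : psi quarter_turn = quarter_turn.
  apply: (F _ 0 0); rewrite /angular /height /arow /quarter_turn ?mxE /=;
    try by move=> *; rewrite ?mxE /=; ring.
    by rewrite expr0n addr0.
  by move=> p q pq; rewrite ?mxE /=; lra.
have F00 : psi (quarter_turn + delta_mx o0 o0) = quarter_turn + delta_mx o0 o0.
  apply: (F _ 0 0); rewrite /angular /height /arow /quarter_turn ?mxE /=;
    try by move=> *; rewrite ?mxE /=; ring.
    by rewrite expr0n addr0.
  move=> p q pq; rewrite ?mxE /=; have := sqr_ge0 (p - q); lra.
have F10 : psi (quarter_turn + delta_mx o1 o0) = quarter_turn + delta_mx o1 o0.
  apply: (F _ 0 0); rewrite /angular /height /arow /quarter_turn ?mxE /=;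
    try by move=> *; rewrite ?mxE /=; ring.
    by rewrite expr0n addr0.
  move=> p q pq; rewrite ?mxE /=; have := sqr_ge0 p; lra.
(* The factor 1/2 keeps the zero of the planar part inside the disk, and [angular] = 1 - q / 2
   positive on the circle. *)
have F02 : psi (quarter_turn + 2^-1 *: delta_mx o0 o2) =
    quarter_turn + 2^-1 *: delta_mx o0 o2.
  apply: (F _ 0 2^-1); rewrite /angular /height /arow /quarter_turn ?mxE /=;
    try by move=> *; rewrite ?mxE /=; field.
    rewrite expr2; lra.
  move=> p q pq; rewrite ?mxE /=; have := sqr_ge0 (q - 1); have := sqr_ge0 p; lra.
have F12 : psi (quarter_turn + 2^-1 *: delta_mx o1 o2) =
    quarter_turn + 2^-1 *: delta_mx o1 o2.
  apply: (F _ (- 2^-1) 0); rewrite /angular /height /arow /quarter_turn ?mxE /=;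
    try by move=> *; rewrite ?mxE /=; field.
    rewrite expr2; lra.
  move=> p q pq; rewrite ?mxE /=; have := sqr_ge0 (p + 1); have := sqr_ge0 q; lra.
have G B C : psi B = B -> psi (B + C) = B + C -> psi C = C.
  by move=> eB; rewrite linearD eB => /addrI.
have e00 := G _ _ FJ F00; have e10 := G _ _ FJ F10.
have GZ C : psi (2^-1 *: C) = 2^-1 *: C -> psi C = C.
  by rewrite linearZ_LR => /scalerI; apply; rewrite invr_eq0 pnatr_eq0.
have e02 := GZ _ (G _ _ FJ F02); have e12 := GZ _ (G _ _ FJ F12).
have e01 : psi (delta_mx o0 o1) = delta_mx o0 o1.
  by move: FJ; rewrite /quarter_turn linearB e10 => /addrI/oppr_inj.
have := psi_flat 1 0 0 0; have := psi_flat 0 1 0 0; have := psi_flat 0 0 1 0.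
have := psi_flat 0 0 0 1.
rewrite /flat3 !scale0r !scale1r !addr0 !add0r => e22 e21 e20 /(G _ _ e00) e11.
rewrite {1}(matrix_sum_delta A) [RHS](matrix_sum_delta A).
rewrite linear_sum; apply: eq_bigr => i _; rewrite linear_sum; apply: eq_bigr => j _.
rewrite [LHS]linearZ_LR; congr (_ *: _).
by move: i j; apply: ord3P; apply: ord3P.
Qed.
End FlatFixing.

(** * Conjugation by rotations of the cone *)

Section Conjugation.
Variables (R : realType) (n : nat).
Implicit Types (Q : 'M[R]_n) (A : 'M[R]_(n + 1)) (x : 'cV[R]_(n + 1)).

Definition rotation Q : 'M[R]_(n + 1) := block_mx Q 0 0 1%:M.

Lemma rotation_tr Q : (rotation Q)^T = rotation Q^T.
Proof. by rewrite /rotation tr_block_mx !trmx0 trmx1. Qed.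

Lemma rotationM Q Q' : rotation Q *m rotation Q' = rotation (Q *m Q').
Proof. by rewrite /rotation mulmx_block !mulmx0 !mul0mx mulmx1 !addr0 add0r. Qed.

Lemma rotation1 : rotation 1%:M = 1%:M.
Proof. by rewrite /rotation -scalar_mx_block. Qed.

Lemma norm2_orthogonal Q (u : 'cV[R]_n) : Q^T *m Q = 1%:M ->
  norm2 (Q *m u) = norm2 u.
Proof.
move=> QQ; have E (v : 'cV[R]_n) : \sum_(i < n) v i 0 ^+ 2 = (v^T *m v) 0 0.
  by rewrite !mxE; apply: eq_bigr => i _; rewrite mxE expr2.
by rewrite /norm2 !E trmx_mul -mulmxA (mulmxA Q^T) QQ mul1mx.
Qed.

Lemma lorentz_cone_rotation Q x : Q^T *m Q = 1%:M ->
  lorentz_cone (rotation Q *m x) <-> lorentz_cone x.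
Proof.
move=> QQ; rewrite /lorentz_cone /= -{1 2}[x]vsubmxK /rotation mul_block_col.
rewrite !mul0mx addr0 add0r mul1mx col_mxKu col_mxKd norm2_orthogonal //.
Qed.

(** The rotation preserves the cone and inner products, so it carries eigenvectors to eigenvectors
    of the conjugate. *)
Lemma lorentz_spectrum_rotation_sub Q A lam : Q^T *m Q = 1%:M ->
  lorentz_spectrum A lam ->
  lorentz_spectrum (rotation Q *m A *m rotation Q^T) lam.
Proof.
move=> QQ [x [x0 Kx Kax dot]]; set P := rotation Q.
have PP : P^T *m P = 1%:M by rewrite rotation_tr rotationM QQ rotation1.
have E : (P *m A *m rotation Q^T - lam%:M) *m (P *m x) = P *m ((A - lam%:M) *m x).
  rewrite -rotation_tr -/P !mulmxBl mulmxBr -!mulmxA (mulmxA P^T) PP mul1mx.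
  by rewrite !mul_scalar_mx -scalemxAr.
exists (P *m x); rewrite E; split.
- by apply: contraNneq x0 => Px0; rewrite -[x]mul1mx -PP -mulmxA Px0 mulmx0.
- by apply/lorentz_cone_rotation.
- by apply/lorentz_cone_rotation.
- by rewrite trmx_mul -mulmxA (mulmxA P^T) PP mul1mx.
Qed.

Lemma lorentz_spectrum_rotation Q A : Q^T *m Q = 1%:M ->
  lorentz_spectrum (rotation Q *m A *m rotation Q^T) = lorentz_spectrum A.
Proof.
move=> QQ; have QQ' : Q *m Q^T = 1%:M by apply: mulmx1C.
apply/funext => lam; apply/propext; split; last exact: lorentz_spectrum_rotation_sub.
move=> /(@lorentz_spectrum_rotation_sub Q^T); rewrite trmxK => /(_ QQ').
by rewrite !mulmxA rotationM QQ rotation1 mul1mx -mulmxA rotationM QQ rotation1 mulmx1.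
Qed.
End Conjugation.

Definition row2 (R : realType) (c e : R) : 'rV[R]_2 := \row_j [:: c; e]`_j.

Lemma flat3_block (R : realType) (a c e d : R) :
  flat3 a c e d = block_mx a%:M 0 (row2 c e) d%:M.
Proof.
have E0 : o0 = lshift 1 (0 : 'I_2) by apply/val_inj.
have E1 : o1 = lshift 1 (1 : 'I_2) by apply/val_inj.
have E2 : o2 = rshift 2 (0 : 'I_1) by apply/val_inj.
apply/matrixP; apply: ord3P; apply: ord3P;
  rewrite /flat3 ?E0 ?E1 ?E2 ?block_mxEul ?block_mxEur ?block_mxEdl ?block_mxEdr;
  by rewrite !mxE /=; ring.
Qed.

Lemma row2_mul (R : realType) (Q : 'M[R]_2) (c e : R) :
  row2 (Q 0 0 * c + Q 0 1 * e) (Q 1 0 * c + Q 1 1 * e) = row2 c e *m Q^T.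
Proof.
apply/rowP => j; rewrite !mxE !big_ord_recl big_ord0 !mxE /= addr0.
have -> : lift ord0 ord0 = 1 :> 'I_2 by apply/val_inj.
case: j => [[|[|//]] j2] /=.
- have -> : Ordinal j2 = 0 by apply/val_inj.
  by ring.
- have -> : Ordinal j2 = 1 by apply/val_inj.
  by ring.
Qed.

Lemma rotation_flat3 (R : realType) (Q : 'M[R]_2) (a c e d : R) :
  Q^T *m Q = 1%:M ->
  rotation Q^T *m
    flat3 a (Q 0 0 * c + Q 0 1 * e) (Q 1 0 * c + Q 1 1 * e) d *m rotation Q
  = flat3 a c e d.
Proof.
move=> QQ; rewrite !flat3_block row2_mul /rotation !mulmx_block.
rewrite !mulmx0 !mul0mx !mulmx1 !mul1mx !addr0 !add0r mul_mx_scalar.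
by rewrite -scalemxAl -mulmxA QQ mulmx1 scalemx1.
Qed.

Theorem theorem3p1 (R : realType)
    (phi : {linear 'M[R]_(2 + 1) -> 'M[R]_(2 + 1)})
    (hphi : lorentz_spectrum_preserver phi) :
  exists Q : 'M[R]_2,
    orthogonal_mx Q /\
    forall A : 'M[R]_(2 + 1),
      phi A = block_mx Q 0 0 1%:M *m A *m block_mx Q^T 0 0 1%:M.
Proof.
have [Q QQ phi_flat] := preserver_flat hphi.
have QQ' : Q *m Q^T = 1%:M by apply: mulmx1C.
exists Q; split=> // A.
(* Undoing the rotation by [Q] gives a preserver that fixes all flat matrices, hence the
   identity. *)
pose psi : {linear 'M[R]_(2 + 1) -> 'M[R]_(2 + 1)} :=
  mulmx (rotation Q^T) \o mulmxr (rotation Q) \o phi.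
have psiE B : psi B = rotation Q^T *m phi B *m rotation Q by rewrite /= mulmxA.
have hpsi : lorentz_spectrum_preserver psi.
  move=> B; rewrite psiE -[in rotation Q](trmxK Q).
  by rewrite lorentz_spectrum_rotation ?trmxK.
have psi_flat a c e d : psi (flat3 a c e d) = flat3 a c e d.
  by rewrite psiE phi_flat rotation_flat3.
have := fix_flat_id hpsi psi_flat A; rewrite psiE => psiA.
rewrite -!/(rotation _) -[A in RHS]psiA !mulmxA rotationM QQ' rotation1 mul1mx.
by rewrite -mulmxA rotationM QQ' rotation1 mulmx1.
Qed.
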